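(* Let $C_1$ and $C_2$ be chains (totally ordered sets) and let $Y$ be a bounded sublattice of $C_1\times C_2$ (with the coordinatewise order). Then $\operatorname{DM}(Y)$ is distributive. Consequently there is no bounded sublattice $Y\subseteq\mathbb R^2$ (regular or otherwise) whose Dedekind–MacNeille completion is non-modular.
   Context: A sublattice $Y$ is bounded if $Y$, as a lattice, has a least and a greatest element. A sublattice is closed under binary joins and meets of the ambient lattice. For $A\subseteq Y$, $A^+$ and $A^-$ denote the sets of upper and lower bounds of $A$ in $Y$. The Dedekind–MacNeille completion $\operatorname{DM}(Y)$ is the complete lattice of all $C\subseteq Y$ with $C=C^{+-}$, ordered by inclusion. A sublattice $Y$ of a lattice $X$ is regular in $X$ if every supremum or infimum of a nonempty subset of $Y$ that exists in $Y$ also exists in $X$, with the same value. *)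

(* Defs.v *)
From HB Require Import structures.
From mathcomp Require Import all_boot all_order.
From mathcomp Require Import boolp classical_sets.

Set Implicit Arguments.
Unset Strict Implicit.
Unset Printing Implicit Defensive.

Import Order.Theory.
Local Open Scope order_scope.
Local Open Scope classical_set_scope.

Section Lattices.
Context {d : Order.disp_t}.

Definition distributive_lattice (L : latticeType d) : Prop :=
  left_distributive (@Order.meet d L) (@Order.join d L).

Definition modular_lattice (L : latticeType d) : Prop :=
  forall x y z : L, x <= z ->
    Order.join x (Order.meet y z) = Order.meet (Order.join x y) z.

Definition is_sublattice (X : latticeType d) (Y : set X) : Prop :=
  forall x y : X, Y x -> Y y -> Y (Order.meet x y) /\ Y (Order.join x y).

(* The least and greatest elements are those of Y itself; the ambient
   lattice X need not have any. *)
Definition bounded_sublattice (X : latticeType d) (Y : set X) : Prop :=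
  [/\ is_sublattice Y, Y `&` lbound Y !=set0 & Y `&` ubound Y !=set0].

End Lattices.

Section DedekindMacNeille.
Context {d : Order.disp_t} {X : porderType d}.
Implicit Types (Y A B : set X).

(* A^+ and A^- : the bounds are taken in Y, not in the ambient order X. *)
Definition uppers Y A : set X := Y `&` ubound A.
Definition lowers Y A : set X := Y `&` lbound A.

(* No clause C `<=` Y is needed: lowers Y _ is a subset of Y. *)
Record DM Y := MkDM {
  DM_set : set X;
  _ : `[< DM_set = lowers Y (uppers Y DM_set) >] }.

HB.instance Definition _ Y := [isSub for @DM_set Y].
HB.instance Definition _ Y := [Choice of DM Y by <:].

Fact DM_display : Order.disp_t. Proof. exact: Order.Disp tt tt. Qed.

(* The order of [set X] is inclusion. *)
HB.instance Definition _ Y :=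
  [SubChoice_isSubPOrder of DM Y by <: with DM_display].

Section Theory.
Context {Y : set X}.
Implicit Types C D E : DM Y.

Lemma DM_closed C : DM_set C = lowers Y (uppers Y (DM_set C)).
Proof. by case: C => C /= /asboolP. Qed.

Lemma DM_leP C D : (C <= D) <-> DM_set C `<=` DM_set D.
Proof.
have -> : (C <= D) = (DM_set C <= DM_set D)%O by [].
by rewrite subsetEset.
Qed.

Lemma DM_sub C : DM_set C `<=` Y.
Proof. by rewrite DM_closed => x []. Qed.

Lemma sub_closure A : A `<=` Y -> A `<=` lowers Y (uppers Y A).
Proof. by move=> AY x Ax; split; [exact: AY | move=> u [_]; apply]. Qed.

Lemma uppersS A B : A `<=` B -> uppers Y B `<=` uppers Y A.
Proof. by move=> AB x [Yx Bx]; split=> // a /AB; exact: Bx. Qed.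

Lemma lowersS A B : A `<=` B -> lowers Y B `<=` lowers Y A.
Proof. by move=> AB x [Yx Bx]; split=> // a /AB; exact: Bx. Qed.

Lemma closure_idem A : A `<=` Y ->
  `[< lowers Y (uppers Y A)
      = lowers Y (uppers Y (lowers Y (uppers Y A))) >].
Proof.
move=> AY; apply/asboolP/seteqP; split.
  by apply: sub_closure => x [].
apply: lowersS => u [Yu uA]; split=> // x [_]; apply.
by split.
Qed.

Definition DM_closure A (AY : A `<=` Y) : DM Y := MkDM (closure_idem AY).

Lemma DM_closure_le A (AY : A `<=` Y) C :
  (DM_closure AY <= C) <-> A `<=` DM_set C.
Proof.
rewrite DM_leP /=; split=> [|AC].
  by apply: subset_trans; exact: sub_closure.
by rewrite DM_closed; apply/lowersS/uppersS.
Qed.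

Lemma DM_setI_closed C D :
  `[< DM_set C `&` DM_set D
      = lowers Y (uppers Y (DM_set C `&` DM_set D)) >].
Proof.
apply/asboolP/seteqP; split.
  by apply: sub_closure => x [/DM_sub].
move=> x Hx; split; rewrite DM_closed;
  by apply: lowersS Hx; apply: uppersS => y [].
Qed.

Definition DM_meet C D : DM Y := MkDM (DM_setI_closed C D).

Lemma DM_setU_sub C D : DM_set C `|` DM_set D `<=` Y.
Proof. by move=> x [] /DM_sub. Qed.

Definition DM_join C D : DM Y := DM_closure (@DM_setU_sub C D).

Lemma DM_lexI C D E : (C <= DM_meet D E) = (C <= D) && (C <= E).
Proof.
apply/idP/andP => [/DM_leP H|[/DM_leP CD /DM_leP CE]].
  by split; apply/DM_leP => x /H [].
by apply/DM_leP => x Cx; split; [exact: CD | exact: CE].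
Qed.

Lemma DM_leUx C D E : (DM_join C D <= E) = (C <= E) && (D <= E).
Proof.
apply/idP/andP => [/DM_closure_le H|[/DM_leP CE /DM_leP DE]].
  by split; apply/DM_leP => x Cx; apply: H; [left | right].
by apply/DM_closure_le => x [/CE|/DE].
Qed.

End Theory.

HB.instance Definition _ Y :=
  Order.POrder_isMeetSemilattice.Build DM_display (DM Y) (@DM_lexI Y).
HB.instance Definition _ Y :=
  Order.POrder_isJoinSemilattice.Build DM_display (DM Y) (@DM_leUx Y).

(* DM Y is a complete lattice: every family has a least upper bound. *)
Lemma DM_complete Y (F : set (DM Y)) : exists S : DM Y,
  ubound F S /\ lbound (ubound F) S.
Proof.
have FY : [set x | exists2 C, F C & DM_set C x] `<=` Y.
  by move=> x [C _ /DM_sub].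
exists (DM_closure FY); split=> [C FC|D ubD].
  apply/DM_leP => x Cx; apply: (sub_closure FY).
  by exists C.
by apply/DM_closure_le => x [C /ubD /DM_leP]; apply.
Qed.

End DedekindMacNeille.

(* Main.v *)
Require Import Defs.
From mathcomp Require Import all_boot all_order.
From mathcomp Require Import boolp classical_sets reals.

Set Implicit Arguments.
Unset Strict Implicit.
Unset Printing Implicit Defensive.

Import Order.Theory.
Local Open Scope order_scope.

(** Infinite distributivity can fail in [DM Y], even for [Y] inside a product
    of two chains, so the argument has to use that the members of [DM Y] are
    intersections of principal ideals.

    Let [A], [B] and [C] be in [DM Y], let [p] be in the meet of [C] with the
    join of [A] and [B], and let [u] be an upper bound in [Y] of the traces of
    [A] and [B] on [C]; the point is that [p <= u].  If [p] lies in [A] or in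
    [B], this is clear.  Otherwise closedness gives upper bounds [v] of [A] and
    [w] of [B] that are not above [p], while [p <= v `|` w].  With only two
    coordinates available, [v] must fall short of [p] in exactly one of them
    and [w] in exactly the other.  If [p <= u] fails, [u] falls short of [p] in
    some coordinate, hence together with one of [v] and [w], say [v].  Then
    [u `|` v] still falls short of [p] in that coordinate, but it is an upper
    bound of [A] and of [B] ([join_upper_bound]): below [p], an element of [B]
    is controlled by [u] in the coordinate where [u] is small and by [w] in the
    other one, where [w] is below [p] and hence below [v].  This contradicts
    that [p] lies in the join of [A] and [B].

    Distributivity implies modularity, and the real plane is a product of two
    chains. *)

(** The two projections of a product of chains, in either order.  Stating the
    argument for a pair of such maps lets one proof serve for both
    coordinates. *)
Definition chain_coordinates (d d1 d2 : Order.disp_t) (X : latticeType d)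
    (C1 : orderType d1) (C2 : orderType d2) (f : X -> C1) (g : X -> C2) :=
  [/\ forall x y, (x <= y) = (f x <= f y) && (g x <= g y),
      {morph f : x y / x `&` y}, {morph f : x y / x `|` y}
    & {morph g : x y / x `|` y}].

Section TwoCoordinates.
Context {d d1 d2 : Order.disp_t} {X : latticeType d}.
Context {C1 : orderType d1} {C2 : orderType d2} {f : X -> C1} {g : X -> C2}.
Implicit Types (Y A B : set X) (p u v w : X).

(** Here [u] and [v] fall short of [p] in the same coordinate [f].  The set [B]
    is below [u] for [f] and below [w], which is smaller than [v], for [g]. *)
Lemma join_upper_bound A B p u v w : chain_coordinates f g ->
    f u < f p -> f v < f p -> p <= v `|` w -> ~~ (p <= w) ->
    ubound A v -> ubound B w -> (forall b, B b -> b `&` p <= u) ->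
  ubound (A `|` B)%classic (u `|` v) /\ ~~ (p <= u `|` v).
Proof.
move=> [leE fI fU gU] fup fvp; rewrite !leE fU gU !lexU leNgt fvp /=.
move=> /andP[fpw +]; rewrite fpw /= -ltNge => gpvw gwp Av Bw Bu.
have {}gpvw : g p <= g v by move: gpvw; rewrite (leNgt _ (g w)) gwp orbF.
split; last by rewrite fU lexU !leNgt fup fvp.
move=> x [/Av xv|Bx]; first exact: le_trans xv (leUr _ _).
move: (Bu x Bx) (Bw x Bx); rewrite !leE fI fU gU !lexU leIx.
rewrite [f p <= _]leNgt fup orbF => /andP[-> _] /andP[_ gxw] /=.
by rewrite (le_trans gxw (ltW (lt_le_trans gwp gpvw))) orbT.
Qed.

(** If the inequality failed, [u] could be joined with whichever of [v] and [w]
    is also too small for [f].  There is such a one: if [v] and [w] were both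
    too small for [g] only, their join would not be above [p]. *)
Lemma coordinate_le Y A B p u v w : chain_coordinates f g ->
    is_sublattice Y -> Y u -> Y v -> Y w ->
    lbound (uppers Y (A `|` B)%classic) p -> ~~ (p <= v) -> ~~ (p <= w) ->
    ubound A v -> ubound B w ->
    (forall x, (A `|` B)%classic x -> x `&` p <= u) ->
  f p <= f u.
Proof.
move=> fg Ylat Yu Yv Yw pAB pv pw Av Bw ABu.
rewrite leNgt; apply/negP => fup.
have YU x y : Y x -> Y y -> Y (x `|` y) by move=> Yx Yy; case: (Ylat x y).
have pvw : p <= v `|` w.
  apply: pAB; split; first exact: YU.
  by move=> x [/Av|/Bw] xle; apply: le_trans xle _; rewrite ?leUl ?leUr.
have [fvp|fpv] := ltP (f v) (f p).
  have [b Bb|ub /negP[]] := join_upper_bound fg fup fvp pvw pw Av Bw.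
    by apply: ABu; right.
  by apply: pAB; split=> //; exact: YU.
have fwp : f w < f p.
  have [leE _ _ gU] := fg.
  move: pv pw pvw; rewrite !leE fpv gU lexU /= => /negPf-> /=.
  by case/nandP=> [|/negPf->]; rewrite -?ltNge // andbF.
rewrite joinC in pvw.
have [a Aa|ub /negP[]] := join_upper_bound fg fup fwp pvw pv Bw Av.
  by apply: ABu; left.
by apply: pAB; split; [exact: YU | rewrite setUC].
Qed.

End TwoCoordinates.

Lemma fst_snd_coordinates (d1 d2 : Order.disp_t) (C1 : orderType d1)
    (C2 : orderType d2) :
  chain_coordinates (fst : (C1 *p C2)%type -> C1) (snd : (C1 *p C2)%type -> C2).
Proof. by split=> //= x y; rewrite leEprod. Qed.

Lemma snd_fst_coordinates (d1 d2 : Order.disp_t) (C1 : orderType d1)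
    (C2 : orderType d2) :
  chain_coordinates (snd : (C1 *p C2)%type -> C2) (fst : (C1 *p C2)%type -> C1).
Proof. by split=> //= x y; rewrite leEprod andbC. Qed.

(** [C], being closed, is an intersection of principal ideals of [Y], so one of
    these excludes [p].  The lemma is applied to both sides of a join, which is
    why finite distributivity survives where infinite distributivity may
    not. *)
Lemma DM_separation (d : Order.disp_t) (X : porderType d) (Y : set X)
    (C : DM Y) (p : X) : Y p -> ~ DM_set C p ->
  exists v, [/\ Y v, ubound (DM_set C) v & ~~ (p <= v)].
Proof.
move=> Yp; apply: contra_notP => noub; rewrite DM_closed; split=> // v [Yv Cv].
by apply/negPn/negP => pv; apply: noub; exists v.
Qed.

Lemma DM_down (d : Order.disp_t) (X : porderType d) (Y : set X) (C : DM Y)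
    (x y : X) : Y x -> x <= y -> DM_set C y -> DM_set C x.
Proof.
move=> Yx xy; rewrite DM_closed => -[_ Cy]; split=> // u /Cy.
exact: le_trans.
Qed.

Lemma DM_distributive (d1 d2 : Order.disp_t) (C1 : orderType d1)
    (C2 : orderType d2) (Y : set (C1 *p C2)%type) :
  is_sublattice Y -> distributive_lattice (DM Y).
Proof.
move=> Ylat A B C; apply/le_anti/andP; split; last first.
  by rewrite leUx !lexI !leIr !leIxl ?leUl ?leUr.
apply/DM_leP => p [[Yp pAB] Cp]; split=> // u [Yu ABCu].
have [Ap|nAp] := pselect (DM_set A p); first by apply: ABCu; left.
have [Bp|nBp] := pselect (DM_set B p); first by apply: ABCu; right.
have [v [Yv Av pv]] := DM_separation Yp nAp.
have [w [Yw Bw pw]] := DM_separation Yp nBp.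
have ABu x : (DM_set A `|` DM_set B)%classic x -> x `&` p <= u.
  move=> ABx; have Yx : Y x by case: ABx => /DM_sub.
  have Yxp : Y (x `&` p) by case: (Ylat x p).
  apply: ABCu; case: ABx => Dx; [left|right];
    by split; [exact: DM_down Yxp (leIl _ _) Dx | exact: DM_down (leIr _ _) Cp].
have leu1 := coordinate_le (@fst_snd_coordinates _ _ C1 C2) Ylat
  Yu Yv Yw pAB pv pw Av Bw ABu.
have leu2 := coordinate_le (@snd_fst_coordinates _ _ C1 C2) Ylat
  Yu Yv Yw pAB pv pw Av Bw ABu.
by rewrite leEprod leu1.
Qed.

Lemma distributive_modular (d : Order.disp_t) (L : latticeType d) :
  distributive_lattice L -> modular_lattice L.
Proof. by move=> distrL x y z xz; rewrite distrL (meet_l xz). Qed.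

Theorem theorem4p4 :
  (forall (d1 d2 : Order.disp_t) (C1 : orderType d1) (C2 : orderType d2)
      (Y : set (C1 *p C2)%type),
    bounded_sublattice Y -> distributive_lattice (DM Y))
  /\
  (forall R : realType,
    ~ exists Y : set (R *p R)%type,
        bounded_sublattice Y /\ ~ modular_lattice (DM Y)).
Proof.
split=> [d1 d2 C1 C2 Y [Ylat _ _]|R [Y [[Ylat _ _]]]].
  exact: DM_distributive.
by apply; apply/distributive_modular/DM_distributive.
Qed.
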